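(* Let $X\in\mathbb{M}^s_{n,\alpha_1}$ and $Y\in\mathbb{M}^s_{n,\alpha_2}$, where $\alpha_1,\alpha_2\in[0,\pi/2)$. Then $$\omega(X\circ Y)\le\min\left\{(1+\tan\alpha_1)\,\omega(\operatorname{Re}X)\,\omega(Y),\ (1+\tan\alpha_2)\,\omega(X)\,\omega(\operatorname{Re}Y)\right\}.$$ Consequently, $$\omega(X\circ Y)\le(1+\tan\alpha)\,\omega(X)\,\omega(Y),$$ where $\alpha=\max\{\alpha_1,\alpha_2\}$.
   Context: $\mathbb{M}_n$ is the algebra of all $n\times n$ complex matrices. For $X=[x_{ij}],Y=[y_{ij}]\in\mathbb{M}_n$ the Hadamard product is $X\circ Y=[x_{ij}y_{ij}]$, and $\operatorname{Re}X=\frac{X+X^*}{2}$. The numerical range of $X\in\mathbb{M}_n$ is $W(X)=\{\langle Xx,x\rangle : x\in\mathbb{C}^n,\ \|x\|=1\}$, with the standard inner product and Euclidean norm on $\mathbb{C}^n$, and the numerical radius is $\omega(X)=\sup\{|z| : z\in W(X)\}$. For $\alpha\in[0,\pi/2)$ let $S_\alpha=\{z\in\mathbb{C} : \operatorname{Re}(z)>0,\ |\operatorname{Im}(z)|\le\tan(\alpha)\operatorname{Re}(z)\}$, and let $\mathbb{M}^s_{n,\alpha}$ be the class of all $X\in\mathbb{M}_n$ such that $W(zX)\subset S_\alpha$ for some $z\in\mathbb{C}$ with $|z|=1$.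
   Formalization: In the first inequality Re X and Re Y are replaced by Re(z1 X) and Re(z2 Y), for any unimodular z1, z2 with W(z1 X) in S_α1 and W(z2 Y) in S_α2; as printed it fails for n=1, α1=α2=0, X=[i], Y=[1]. The second inequality is unchanged. *)

(* Defs.v *)
From HB Require Import structures.
From mathcomp Require Import all_boot all_order all_algebra.
From mathcomp Require Import sesquilinear spectral.
From mathcomp Require Import complex.
From mathcomp Require Import boolp classical_sets reals trigo.

Set Implicit Arguments.
Unset Strict Implicit.
Unset Printing Implicit Defensive.

Import Order.TTheory GRing.Theory Num.Theory.

Local Open Scope ring_scope.
Local Open Scope classical_set_scope.
Local Open Scope sesquilinear_scope.

Section NumericalRange.
Variable R : realType.
Local Notation C := R[i].

Definition hadamard n (X Y : 'M[C]_n) : 'M[C]_n := map2_mx *%R X Y.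

Definition Repart n (X : 'M[C]_n) : 'M[C]_n := 2^-1 *: (X + X ^t*).

(* [dotmx] is a form on row vectors, linear in its first argument:
   [dotmx u v] is the sum of the [u 0 i * (v 0 i)^*]. *)
Definition inner n (x y : 'cV[C]_n) : C := dotmx x^T y^T.

Definition enorm n (x : 'cV[C]_n) : C := sqrtC (inner x x).

Definition numrange n (X : 'M[C]_n) : set C :=
  [set inner (X *m x) x | x in [set x : 'cV[C]_n | enorm x = 1]].

(* The norm of [R[i]] takes its values in [R[i]]; [complex.Re] brings the
   modulus back to [R], where [sup] is available. *)
Definition numradius n (X : 'M[C]_n) : R :=
  sup [set complex.Re `|z| | z in numrange X].

Definition sector (alpha : R) : set C :=
  [set z | 0 < complex.Re z /\ `|complex.Im z| <= tan alpha * complex.Re z].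

Definition rotates_into_sector n (alpha : R) (z : C) (X : 'M[C]_n) : Prop :=
  `|z| = 1 /\ numrange (z *: X) `<=` sector alpha.

(* Membership in this class is invariant under [X |-> u *: X] with [`|u| = 1],
   whereas [Repart] is not: ['i *: 1] belongs to the class for [alpha = 0] and
   its real part is [0].  Bounds involving real parts are therefore stated for
   [Repart (z *: X)] with [z] such that [rotates_into_sector alpha z X]; for
   matrices already in sectorial position, [z = 1] gives [Repart X]. *)
Definition sectorial n (alpha : R) (X : 'M[C]_n) : Prop :=
  exists z : C, rotates_into_sector alpha z X.

End NumericalRange.

(* Main.v *)
(* After a rotation X = A + i B with A and B Hermitian, A >= 0 and
   -tA <= B <= tA, t = tan alpha.  A positive semidefinite P factors as V V^*,
   so the form of the Hadamard product of P and Y at x is a sum of forms of Y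
   at the vectors u_k with entries conj(V_jk) x_j; hence its modulus is at most
   omega(Y) times the sum of the P_ii |x_i|^2.  Applying this to A and to
   P1, P2 = tA + B, tA - B, with i B = (i/2)(P1 - P2) and P1 + P2 = 2tA, gives
   omega(Y) (1 + t) times the sum of the A_ii |x_i|^2, and A_ii <= omega(A). *)

Require Import Defs.
From HB Require Import structures.
From mathcomp Require Import all_boot all_order all_algebra.
From mathcomp Require Import sesquilinear spectral.
From mathcomp Require Import complex.
From mathcomp Require Import boolp classical_sets reals trigo.
From mathcomp Require Import ring lra.

Set Implicit Arguments.
Unset Strict Implicit.
Unset Printing Implicit Defensive.

Import Order.TTheory GRing.Theory Num.Theory.

Local Open Scope ring_scope.

(** This is the triangle inequality with [|'i / 2| = 1/2]: the last two terms contribute at most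
    [w * (sp + sq) / 2 = w * t * sa]. In the application [a], [p], [q] are values of forms and [sa],
    [sp], [sq] are weighted diagonal sums. *)
Lemma norm_halved_comb_le (F : numClosedFieldType) (t w a p q sa sp sq N : F) :
  0 <= t -> 0 <= w -> `|a| <= w * sa -> `|p| <= w * sp -> `|q| <= w * sq ->
  sp + sq = 2 * t * sa -> sa <= N ->
  `|a + ('i / 2 * p + - ('i / 2) * q)| <= (1 + t) * w * N.
Proof.
move=> t_ge0 w_ge0 ha hp hq sE saN.
have i2 : `|'i / 2 : F| = 2^-1.
  by rewrite normrM normCi mul1r normfV normr_nat.
apply: (@le_trans _ _ (w * sa + (2^-1 * (w * sp) + 2^-1 * (w * sq)))).
  apply: le_trans (ler_normD _ _) _; apply: lerD => //.
  apply: le_trans (ler_normD _ _) _.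
  rewrite mulNr normrN !(normrM ('i / 2)) i2.
  by apply: lerD; apply: ler_wpM2l; rewrite ?invr_ge0.
rewrite -!mulrDr sE.
have -> : w * sa + 2^-1 * (w * (2 * t * sa)) = (1 + t) * w * sa by field.
by apply: ler_wpM2l => //; rewrite mulr_ge0 ?addr_ge0.
Qed.

Section NumericalRadius.
Local Open Scope classical_set_scope.
Local Open Scope sesquilinear_scope.
Local Open Scope complex_scope.
Local Open Scope ring_scope.
Variable R : realType.
Variable n : nat.
Local Notation C := R[i].
Implicit Types (X Y P : 'M[C]_n) (x y : 'cV[C]_n).

(** * The inner product and the form of a matrix *)

Lemma innerE x y : inner x y = \sum_i x i 0 * (y i 0)^*.
Proof. by rewrite /inner dotmxE mxE; apply: eq_bigr => i _; rewrite !mxE. Qed.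

Lemma inner_mulmxE X x :
  inner (X *m x) x = \sum_i \sum_j X i j * x j 0 * (x i 0)^*.
Proof.
by rewrite innerE; apply: eq_bigr => i _; rewrite mxE mulr_suml.
Qed.

Lemma inner_sqr x : inner x x = \sum_i `|x i 0| ^+ 2.
Proof. by rewrite innerE; apply: eq_bigr => i _; rewrite normCK. Qed.

Lemma inner_ge0 x : 0 <= inner x x.
Proof. by rewrite inner_sqr; apply: sumr_ge0 => i _; apply: exprn_ge0. Qed.

Lemma innerDl x y v : inner (x + y) v = inner x v + inner y v.
Proof.
rewrite !innerE -big_split; apply: eq_bigr => i _ /=.
by rewrite mxE mulrDl.
Qed.

Lemma innerZl a x y : inner (a *: x) y = a * inner x y.
Proof.
by rewrite !innerE mulr_sumr; apply: eq_bigr => i _; rewrite mxE mulrA.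
Qed.

Lemma innerZr a x y : inner x (a *: y) = a^* * inner x y.
Proof.
rewrite !innerE mulr_sumr; apply: eq_bigr => i _.
by rewrite mxE rmorphM mulrCA.
Qed.

Lemma inner_adjoint X x :
  inner ((X ^t*) *m x) x = (inner (X *m x) x)^*.
Proof.
rewrite !inner_mulmxE exchange_big rmorph_sum; apply: eq_bigr => i _ /=.
rewrite rmorph_sum; apply: eq_bigr => j _ /=.
by rewrite !mxE !rmorphM /= mulrAC [_^*^*]conjCK.
Qed.

Lemma inner_Repart X x :
  inner (Repart X *m x) x = 'Re (inner (X *m x) x).
Proof.
rewrite /Repart -scalemxAl innerZl mulmxDl innerDl inner_adjoint.
by rewrite ReE mulrC.
Qed.

(** * Unit vectors and boundedness of the numerical range *)

Lemma enorm_eq1 x : (enorm x = 1) <-> (inner x x = 1).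
Proof.
rewrite /enorm; split => [e|->]; last by rewrite sqrtC1.
by rewrite -[LHS]sqrtCK e expr1n.
Qed.

Lemma mem_numrange X x : inner x x = 1 -> numrange X (inner (X *m x) x).
Proof. by move=> /enorm_eq1 x1; exists x. Qed.

Lemma entry_le1 x i : inner x x = 1 -> `|x i 0| <= 1.
Proof.
rewrite inner_sqr (bigD1 i) //= => e.
rewrite -(@expr_le1 _ 2) // -e lerDl.
by apply: sumr_ge0 => j _; apply: exprn_ge0.
Qed.

(** Entries of a unit vector have modulus at most 1, so the sum of the moduli of the entries of [X]
    is a bound. This makes the [sup] in [numradius] a genuine upper bound. *)
Lemma numrange_bounded X :
  has_ubound [set complex.Re `|z| | z in numrange X].
Proof.
exists (complex.Re (\sum_i \sum_j `|X i j|)).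
move=> _ [_ [x /enorm_eq1 x1 <-] <-].
(* The order on [R[i]] asks for equal imaginary parts and ordered real parts; proving both turns the
   goal into an inequality in [R[i]]. *)
suff /andP[_ ->] : (complex.Im (\sum_i \sum_j `|X i j|) ==
  complex.Im `|inner (X *m x) x|) &&
  (complex.Re `|inner (X *m x) x| <= complex.Re (\sum_i \sum_j `|X i j|)) by [].
rewrite -lecE inner_mulmxE.
apply: (le_trans (ler_norm_sum _ _ _)); apply: ler_sum => i _.
apply: (le_trans (ler_norm_sum _ _ _)); apply: ler_sum => j _.
by rewrite !normrM norm_conjC -mulrA ler_piMr// mulr_ile1// entry_le1.
Qed.

Lemma Re_normK (z : C) : (complex.Re `|z|)%:C = `|z|.
Proof. by rewrite RRe_real// normr_real. Qed.

Lemma numradius_ge X x : inner x x = 1 ->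
  `|inner (X *m x) x| <= (numradius X)%:C.
Proof.
move=> x1; rewrite -Re_normK lecR.
apply: ub_le_sup; first exact: numrange_bounded.
by exists (inner (X *m x) x) => //; exact: mem_numrange.
Qed.

(** * Homogeneity of forms and bounds by the numerical radius *)

Hypothesis n_gt0 : (0 < n)%N.

Lemma inner_delta X i :
  inner (X *m delta_mx i 0) (delta_mx i 0) = X i i.
Proof.
rewrite inner_mulmxE (bigD1 i)//= (bigD1 i)//= !big1 ?addr0.
- by rewrite !mxE !eqxx conjC1 !mulr1.
- by move=> j /negPf ji; rewrite big1// => k _; rewrite !mxE ji conjC0 mulr0.
- by move=> k /negPf ki; rewrite !mxE ki mulr0 mul0r.
Qed.

Lemma inner_delta1 i : inner (delta_mx i 0 : 'cV[C]_n) (delta_mx i 0) = 1.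
Proof. by have := inner_delta 1%:M i; rewrite mul1mx mxE eqxx. Qed.

(* The scalar is named [q] so that rewriting with the last equation does not
   reintroduce an instance of [inner] that the equation could match. *)
Lemma inner_unit_scale x : exists q y, [/\ q = inner x x, inner y y = 1 &
  forall X, inner (X *m x) x = q * inner (X *m y) y].
Proof.
have [x0|xN0] := eqVneq (inner x x) 0.
  (* Here [x] is zero and every form vanishes at it, so any unit vector serves as [y]. *)
  exists (inner x x), (delta_mx (Ordinal n_gt0) 0).
  split => [//||X]; first exact: inner_delta1.
  rewrite x0 mul0r inner_mulmxE big1// => i _; rewrite big1// => j _.
  apply/eqP; rewrite !mulf_eq0.
  move: x0; rewrite inner_sqr => /eqP; rewrite psumr_eq0; last first.
    by move=> k _; apply: exprn_ge0.
  move=> /allP/(_ j (mem_index_enum _)); rewrite /= expf_eq0 /= normr_eq0.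
  by move=> ->; rewrite orbT.
have cN0 : sqrtC (inner x x) != 0 by rewrite sqrtC_eq0.
have xE : x = sqrtC (inner x x) *: ((sqrtC (inner x x))^-1 *: x).
  by rewrite scalerA divff// scale1r.
have c_real : sqrtC (inner x x) \is Num.real.
  by rewrite ger0_real// sqrtC_ge0 inner_ge0.
have cc : (sqrtC (inner x x))^* = sqrtC (inner x x) by exact/conj_Creal.
have ccV : ((sqrtC (inner x x))^-1)^* = (sqrtC (inner x x))^-1.
  by apply/conj_Creal; rewrite realV.
have c2 : sqrtC (inner x x) * sqrtC (inner x x) = inner x x.
  by rewrite -expr2 sqrtCK.
set c := sqrtC _ in cN0 xE c_real cc ccV c2; set y := c^-1 *: x in xE.
exists (inner x x), y; split => [//||X].
  rewrite innerZl innerZr [_^*]ccV -c2.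
  by have := mulKf cN0 c => /= ->; exact: mulVf.
by rewrite {1 2}xE -scalemxAr innerZl innerZr [_^*]cc mulrA c2.
Qed.

Lemma norm_inner_le X x :
  `|inner (X *m x) x| <= (numradius X)%:C * inner x x.
Proof.
have [q [y [qE y1 ->]]] := inner_unit_scale x.
have q_ge0 : 0 <= q by rewrite qE inner_ge0.
by rewrite -qE normrM (ger0_norm q_ge0) mulrC ler_wpM2r// numradius_ge.
Qed.

Lemma norm_diag_le X i : `|X i i| <= (numradius X)%:C.
Proof. by rewrite -inner_delta numradius_ge// inner_delta1. Qed.

Lemma numradius_ge0 X : 0 <= numradius X.
Proof. by rewrite -ler0c (le_trans _ (norm_diag_le X (Ordinal n_gt0))). Qed.

Lemma numradius_le X (b : R) :
  (forall x, inner x x = 1 -> `|inner (X *m x) x| <= b%:C) -> numradius X <= b.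
Proof.
move=> Xb; apply: ge_sup.
  (* A basis vector shows that the set under [sup] is nonempty. *)
  pose e : 'cV[C]_n := delta_mx (Ordinal n_gt0) 0.
  by eexists; exists (inner (X *m e) e) => //; apply/mem_numrange/inner_delta1.
move=> _ [_ [x /enorm_eq1 x1 <-] <-].
by rewrite -lecR Re_normK; apply: Xb.
Qed.

Lemma numradius_rotate (z : C) X : `|z| = 1 -> numradius (z *: X) = numradius X.
Proof.
(* One inequality suffices: applied to [z^-1] and [z *: X] it gives the reverse one. *)
have le1 (u : C) (Z : 'M[C]_n) : `|u| = 1 -> numradius (u *: Z) <= numradius Z.
  move=> u1; apply: numradius_le => x x1.
  by rewrite -scalemxAl innerZl normrM u1 mul1r numradius_ge.
move=> z1; apply/eqP; rewrite eq_le; apply/andP; split.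
  exact: le1.
have zN0 : z != 0 by rewrite -normr_eq0 z1 oner_eq0.
by rewrite -{1}[X](scalerK zN0); apply: le1; rewrite normfV z1 invr1.
Qed.

Lemma numradius_Repart X : numradius (Repart X) <= numradius X.
Proof.
apply: numradius_le => x x1; rewrite inner_Repart.
apply: le_trans (numradius_ge X x1).
rewrite -complexRe (le_trans _ (normc_ge_Re _))//.
by rewrite normc_def /= expr0n addr0 sqrtr_sqr.
Qed.


(** * Hadamard products with a positive semidefinite factor *)

Lemma hermitian_psd_factor P : P ^t* = P ->
  (forall x, 0 <= inner (P *m x) x) -> exists V : 'M[C]_n, P = V *m V ^t*.
Proof.
move=> Pherm Ppos.
have PH : P \is hermsymmx by apply/is_hermitianmxP; rewrite expr0 scale1r Pherm.
have /orthomx_spectralP PE := hermitian_normalmx PH.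
have QU := spectral_unitarymx P.
rewrite invmx_unitary// in PE.
set Q := spectralmx P in PE QU *; set d := spectral_diag P in PE *.
(* In the spectral decomposition [P = Q ^t* *m diag_mx d *m Q], each eigenvalue is the value of the
   form of [P] at the adjoint of a row of [Q]. Its square root is therefore real, and [Q ^t*] times
   the root of the diagonal is the factor. *)
have d_ge0 k : 0 <= d 0 k.
  have /matrixP/(_ k k) : Q *m P *m Q ^t* = diag_mx d.
    rewrite PE !mulmxA (unitarymxP _)// mul1mx -mulmxA (unitarymxP _)//.
    by rewrite mulmx1.
  rewrite [in RHS]mxE eqxx mulr1n => <-.
  have := Ppos ((row k Q) ^t* ); congr (0 <= _).
  rewrite innerE -mulmxA mxE; apply: eq_bigr => i _.
  rewrite !mxE [_^*^*]conjCK mulrC; congr (_ * _).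
  by apply: eq_bigr => j _; rewrite !mxE.
have sq_real k : (sqrtC (d 0 k))^* = sqrtC (d 0 k).
  by apply/conj_Creal; rewrite ger0_real// sqrtC_ge0.
pose S : 'M[C]_n := diag_mx (map_mx sqrtC d).
have Sherm : S ^t* = S.
  rewrite /S tr_diag_mx map_diag_mx; congr diag_mx.
  by apply/rowP => k; rewrite !mxE; exact: sq_real.
have SS : S *m S = diag_mx d.
  rewrite mulmx_diag; congr diag_mx; apply/rowP => k; rewrite !mxE -expr2.
  exact: sqrtCK.
exists (Q ^t* *m S).
by rewrite trmx_mul map_mxM Sherm trmxCK mulmxA -(mulmxA _ S S) SS.
Qed.

Lemma norm_hadamard_psd_le P Y x : P ^t* = P ->
  (forall y, 0 <= inner (P *m y) y) ->
  `|inner (hadamard P Y *m x) x| <=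
    (numradius Y)%:C * \sum_i P i i * `|x i 0| ^+ 2.
Proof.
move=> Pherm /(hermitian_psd_factor Pherm)[V ->].
(* In [P i j], the sum of the [V i k * (V j k)^*], the second factor is absorbed by [x j 0] and the
   first by the conjugate of [x i 0]. *)
pose u k : 'cV[C]_n := \col_j ((V j k)^* * x j 0).
have -> : inner (hadamard (V *m V ^t* ) Y *m x) x =
    \sum_k inner (Y *m u k) (u k).
  rewrite inner_mulmxE (eq_bigr _ (fun k _ => inner_mulmxE _ _)).
  rewrite [RHS]exchange_big; apply: eq_bigr => i _ /=.
  rewrite [RHS]exchange_big; apply: eq_bigr => j _ /=.
  rewrite !mxE !mulr_suml; apply: eq_bigr => k _.
  rewrite !mxE rmorphM /= [_^*^*]conjCK; ring.
have -> : \sum_i (V *m V ^t* ) i i * `|x i 0| ^+ 2 = \sum_k inner (u k) (u k).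
  rewrite (eq_bigr _ (fun k _ => inner_sqr _)) [RHS]exchange_big.
  apply: eq_bigr => i _ /=; rewrite mxE mulr_suml; apply: eq_bigr => k _.
  by rewrite !mxE normrM norm_conjC exprMn; congr (_ * _); exact/esym/normCK.
rewrite mulr_sumr; apply: (le_trans (ler_norm_sum _ _ _)).
by apply: ler_sum => k _; exact: norm_inner_le.
Qed.

(** * Hadamard algebra and the Cartesian decomposition *)

Lemma hadamardC X Y : hadamard X Y = hadamard Y X.
Proof. by apply/matrixP => i j; rewrite !mxE mulrC. Qed.

Lemma hadamardDl X1 X2 Y :
  hadamard (X1 + X2) Y = hadamard X1 Y + hadamard X2 Y.
Proof. by apply/matrixP => i j; rewrite !mxE mulrDl. Qed.

Lemma hadamardZl a X Y : hadamard (a *: X) Y = a *: hadamard X Y.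
Proof. by apply/matrixP => i j; rewrite !mxE mulrA. Qed.

Definition Impart X : 'M[C]_n := ('i / 2) *: (X ^t* - X).

Lemma inner_Impart X x : inner (Impart X *m x) x = 'Im (inner (X *m x) x).
Proof.
rewrite /Impart -scalemxAl innerZl mulmxBl innerDl -scaleN1r innerZl mulN1r.
by rewrite inner_adjoint ImE mulrAC.
Qed.

Lemma adjointD X Y : (X + Y) ^t* = X ^t* + Y ^t*.
Proof. by rewrite linearD map_mxD. Qed.

Lemma adjointZ (a : C) X : (a *: X) ^t* = a^* *: X ^t*.
Proof. by rewrite linearZ map_mxZ. Qed.

Lemma Repart_herm X : (Repart X) ^t* = Repart X.
Proof.
rewrite adjointZ adjointD trmxCK addrC; congr (_ *: _).
by rewrite [LHS]fmorphV rmorph_nat.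
Qed.

Lemma Impart_herm X : (Impart X) ^t* = Impart X.
Proof.
rewrite adjointZ -scaleN1r adjointD adjointZ trmxCK.
have -> : ('i / 2)^* = - ('i / 2) :> C.
  rewrite [LHS]rmorphM /= conjCi mulNr; congr (- (_ * _)).
  by rewrite [LHS]fmorphV rmorph_nat.
have -> : (-1)^* = -1 :> C by rewrite [LHS]rmorphN1.
by rewrite !scaleN1r scaleNr -scalerN opprB.
Qed.

Lemma Cartesian_decomp X : X = Repart X + 'i *: Impart X.
Proof.
rewrite /Repart /Impart scalerA mulrA -expr2 sqrCi mulN1r scaleNr -scalerN.
rewrite opprB -scalerDr addrACA subrr addr0 scalerDr -scalerDl.
by rewrite -[LHS]scale1r; congr (_ *: _); rewrite [LHS]splitr mul1r.
Qed.

(** * Positivity from the sector condition *)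

Lemma sector_numrange_le alpha X x : numrange X `<=` sector alpha ->
  0 <= (tan alpha)%:C * inner (Repart X *m x) x + inner (Impart X *m x) x /\
  0 <= (tan alpha)%:C * inner (Repart X *m x) x - inner (Impart X *m x) x.
Proof.
(* The sector constrains unit vectors only; scaling by [q >= 0] carries both halves of
   [|Im| <= tan alpha * Re] to every [x]. *)
move=> XS; have [q [y [qE y1 yE]]] := inner_unit_scale x.
have q_ge0 : 0 <= q by rewrite qE inner_ge0.
have reE : inner (Repart X *m x) x = q * (complex.Re (inner (X *m y) y))%:C.
  by rewrite inner_Repart yE ReMl ?ger0_real// -complexRe.
have imE : inner (Impart X *m x) x = q * (complex.Im (inner (X *m y) y))%:C.
  by rewrite inner_Impart yE ImMl ?ger0_real// -complexIm.
have [_] := XS _ (mem_numrange X y1); rewrite ler_norml => /andP[h1 h2].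
suff scaled (u v : C) : u = q * (complex.Re (inner (X *m y) y))%:C ->
    v = q * (complex.Im (inner (X *m y) y))%:C ->
    0 <= (tan alpha)%:C * u + v /\ 0 <= (tan alpha)%:C * u - v.
  exact: scaled reE imE.
move=> -> ->; rewrite !(mulrCA _ q) -mulrDr -mulrBr -rmorphM -rmorphD -rmorphB.
by split; apply: mulr_ge0 => //; rewrite ler0c; lra.
Qed.

Lemma sector_Repart_psd alpha X x : numrange X `<=` sector alpha ->
  0 <= inner (Repart X *m x) x.
Proof.
move=> XS; have [q [y [qE y1 ->]]] := inner_unit_scale x.
have [Re_gt0 _] := XS _ (mem_numrange X y1).
by rewrite inner_Repart -complexRe mulr_ge0 ?qE ?inner_ge0// ler0c ltW.
Qed.

(** A single point of the numerical range decides the sign: 0 <= |Im| <= tan(alpha) Re with Re >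
    0. *)
Lemma sector_tan_ge0 alpha X : numrange X `<=` sector alpha -> 0 <= tan alpha.
Proof.
have e1 := inner_delta1 (Ordinal n_gt0).
move=> XS; have [Re_gt0 Im_le] := XS _ (mem_numrange X e1).
by rewrite -(pmulr_lge0 _ Re_gt0); apply: le_trans Im_le.
Qed.

(** * The estimate in sectorial position and its rotated forms *)

Lemma inner_lincomb (a b : C) X1 X2 x :
  inner ((a *: X1 + b *: X2) *m x) x =
    a * inner (X1 *m x) x + b * inner (X2 *m x) x.
Proof.
rewrite mulmxDl innerDl -(scalemxAl a) -(scalemxAl b).
by rewrite (innerZl a) (innerZl b).
Qed.

(** The sector enters only through positivity of A, tA + B and tA - B, each of which allows one use
    of [norm_hadamard_psd_le]. *)
Lemma numradius_hadamard_le (t : R) (A B Y : 'M[C]_n) :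
  0 <= t -> A ^t* = A -> B ^t* = B ->
  (forall x, 0 <= inner (A *m x) x) ->
  (forall x, 0 <= t%:C * inner (A *m x) x + inner (B *m x) x) ->
  (forall x, 0 <= t%:C * inner (A *m x) x - inner (B *m x) x) ->
  numradius (hadamard (A + 'i *: B) Y) <= (1 + t) * numradius A * numradius Y.
Proof.
move=> t_ge0 Aherm Bherm A_psd AB_psd AB_psd'.
pose P1 := t%:C *: A + 1 *: B; pose P2 := t%:C *: A + (-1) *: B.
have P1_psd y : 0 <= inner (P1 *m y) y by rewrite inner_lincomb mul1r.
have P2_psd y : 0 <= inner (P2 *m y) y by rewrite inner_lincomb mulN1r.
have herm (s : C) : s^* = s -> (t%:C *: A + s *: B) ^t* = t%:C *: A + s *: B.
  move=> sE; rewrite adjointD !adjointZ Aherm Bherm.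
  by congr (_ *: _ + _ *: _) => //; exact: conjc_real.
have P1_herm : P1 ^t* = P1 by apply: herm; rewrite [LHS]rmorph1.
have P2_herm : P2 ^t* = P2 by apply: herm; rewrite [LHS]rmorphN1.
have XE : A + 'i *: B = A + (('i / 2) *: P1 + (- ('i / 2)) *: P2).
  congr (_ + _); rewrite scaleNr -scalerBr /P1 /P2 scale1r scaleN1r.
  rewrite opprD opprK addrACA subrr add0r.
  by rewrite scalerDr -scalerDl -splitr.
have PD i : P1 i i + P2 i i = 2 * t%:C * A i i by rewrite /P1 /P2 !mxE; ring.
clearbody P1 P2.
have A_ge0 i : 0 <= A i i by rewrite -inner_delta.
apply: numradius_le => x x1.
have hA := norm_hadamard_psd_le Y x Aherm A_psd.
have h1 := norm_hadamard_psd_le Y x P1_herm P1_psd.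
have h2 := norm_hadamard_psd_le Y x P2_herm P2_psd.
rewrite XE !hadamardDl !hadamardZl mulmxDl innerDl inner_lincomb.
set a := inner (hadamard A Y *m x) x in hA *.
set p1 := inner (hadamard P1 Y *m x) x in h1 *.
set p2 := inner (hadamard P2 Y *m x) x in h2 *.
set w := (numradius Y)%:C in hA h1 h2.
set sA := \sum_i _ in hA; set s1 := \sum_i _ in h1; set s2 := \sum_i _ in h2.
have w_ge0 : 0 <= w by rewrite ler0c numradius_ge0.
have sE : s1 + s2 = 2 * t%:C * sA.
  rewrite /s1 /s2 /sA mulr_sumr -big_split; apply: eq_bigr => i _ /=.
  by rewrite -mulrDl PD mulrA.
(* The weights [|x i 0| ^+ 2] sum to 1, so [sA] is an average of the diagonal entries of [A]. *)
have sA_le : sA <= (numradius A)%:C.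
  have <- : (numradius A)%:C * inner x x = (numradius A)%:C by rewrite x1 mulr1.
  rewrite inner_sqr mulr_sumr; apply: ler_sum => i _.
  apply: ler_wpM2r; first exact: exprn_ge0.
  by rewrite -[leLHS](ger0_norm (A_ge0 i)); exact: norm_diag_le.
rewrite [leRHS](_ : _ = (1 + t%:C) * w * (numradius A)%:C); last first.
  by rewrite mulrAC !rmorphM rmorphD rmorph1.
by apply: norm_halved_comb_le hA h1 h2 sE sA_le => //; rewrite ler0c.
Qed.

Lemma numradius_hadamard_sector_le alpha X Y : numrange X `<=` sector alpha ->
  numradius (hadamard X Y) <=
    (1 + tan alpha) * numradius (Repart X) * numradius Y.
Proof.
move=> XS; rewrite {1}[X]Cartesian_decomp; apply: numradius_hadamard_le.
- exact: sector_tan_ge0 XS.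
- exact: Repart_herm.
- exact: Impart_herm.
- by move=> x; exact: sector_Repart_psd XS.
- by move=> x; case: (sector_numrange_le x XS).
- by move=> x; case: (sector_numrange_le x XS).
Qed.

Lemma hadamard_rotate (z : C) X Y : `|z| = 1 ->
  numradius (hadamard (z *: X) Y) = numradius (hadamard X Y).
Proof. by move=> z1; rewrite hadamardZl numradius_rotate. Qed.

(** A unit scalar on [X] factors out of the Hadamard product and leaves its numerical radius
    unchanged, while [Y] stays as it is. *)
Lemma numradius_hadamard_rotates_le alpha z X Y :
  rotates_into_sector alpha z X ->
  numradius (hadamard X Y) <=
    (1 + tan alpha) * numradius (Repart (z *: X)) * numradius Y.
Proof.
move=> [z1 XS]; rewrite -(hadamard_rotate X Y z1).
exact: numradius_hadamard_sector_le.
Qed.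

(** The real part of the rotated matrix has numerical radius at most that of the rotated matrix,
    which equals that of [X]; so the rotation disappears from the bound. *)
Lemma numradius_hadamard_sectorial_le alpha X Y : sectorial alpha X ->
  numradius (hadamard X Y) <= (1 + tan alpha) * numradius X * numradius Y.
Proof.
move=> [z zX]; apply: le_trans (numradius_hadamard_rotates_le Y zX) _.
case: zX => z1 /sector_tan_ge0 t_ge0.
apply: ler_wpM2r; first exact: numradius_ge0.
apply: ler_wpM2l; first exact: addr_ge0.
by rewrite -[leRHS](numradius_rotate X z1); exact: numradius_Repart.
Qed.

End NumericalRadius.

Theorem theorem2p6 (R : realType) (n : nat) (n_gt0 : (0 < n)%N)
    (alpha1 alpha2 : R)
    (alpha1_bd : 0 <= alpha1 < pi / 2) (alpha2_bd : 0 <= alpha2 < pi / 2)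
    (X Y : 'M[R[i]]_n)
    (HX : sectorial alpha1 X) (HY : sectorial alpha2 Y) :
  (forall z1 z2 : R[i],
     rotates_into_sector alpha1 z1 X -> rotates_into_sector alpha2 z2 Y ->
     numradius (hadamard X Y) <=
       Num.min
         ((1 + tan alpha1) * numradius (Repart (z1 *: X)) * numradius Y)
         ((1 + tan alpha2) * numradius X * numradius (Repart (z2 *: Y))))
  /\
  numradius (hadamard X Y) <=
    (1 + tan (Num.max alpha1 alpha2)) * numradius X * numradius Y.
Proof.
split=> [z1 z2 zX zY|].
  rewrite le_min; apply/andP; split.
    exact: numradius_hadamard_rotates_le.
  (* Commutativity of the Hadamard product exchanges the roles of [X] and [Y]. *)
  rewrite hadamardC mulrAC; exact: numradius_hadamard_rotates_le.
(* The larger angle belongs to one of the two matrices, and the bound for that matrix is the claim;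
   tangents of different angles are never compared. *)
rewrite maxEle; case: ifP => _; last exact: numradius_hadamard_sectorial_le.
rewrite hadamardC mulrAC; exact: numradius_hadamard_sectorial_le.
Qed.
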